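(* Let $A,B>0$ and $s>0$ be constants (not depending on $n$), and for each positive integer $n$ let $N=N_n\sim\mathrm{Binomial}(\lceil e^{nA}\rceil,e^{-nB})$. Then, as $n\to\infty$, $$\mathbb{E}\left[N^{s}\right]\doteq\begin{cases}e^{n(A-B)s}, & A>B,\\ e^{-n(B-A)}, & A<B.\end{cases}$$
   Context: For two positive sequences $\{a_n\}$ and $\{b_n\}$, the notation $a_n\doteq b_n$ means $\lim_{n\to\infty}\frac{1}{n}\ln\frac{a_n}{b_n}=0$. $\mathrm{Binomial}(m,p)$ is the distribution of the number of successes in $m$ independent trials, each with success probability $p$. *)

(* Defs.v *)
From HB Require Import structures.
From mathcomp Require Import all_boot all_order all_algebra.
From mathcomp Require Import all_classical all_reals all_analysis.
Set Implicit Arguments.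
Unset Strict Implicit.
Unset Printing Implicit Defensive.
Import Order.TTheory GRing.Theory Num.Theory.
Import numFieldNormedType.Exports.
Local Open Scope classical_set_scope.
Local Open Scope ring_scope.

(* Equality to first order in the exponent, for sequences indexed by n >= 1.
   Positivity is part of the relation because [ln] is totalised by [ln x = 0]
   for [x <= 0]: without it the limit would be meaningless.  For a sequence of
   the form [fine (E n)] it also forces [E n] to be finite, as [fine +oo = 0]. *)
Definition exp_equiv (R : realType) (a b : nat -> R) : Prop :=
  [/\ (forall n, (0 < n)%N -> 0 < a n),
      (forall n, (0 < n)%N -> 0 < b n) &
      n%:R^-1 * ln (a n / b n) @[n --> \oo] --> (0 : R)].

(* Main.v *)
Require Import Defs.
From HB Require Import structures.
From mathcomp Require Import all_boot all_order all_algebra.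
From mathcomp Require Import all_classical all_reals all_analysis.
From mathcomp Require Import ring lra.
Set Implicit Arguments.
Unset Strict Implicit.
Unset Printing Implicit Defensive.
Import Order.TTheory GRing.Theory Num.Theory.
Import numFieldNormedType.Exports.
Local Open Scope classical_set_scope.
Local Open Scope ring_scope.

(**
  It suffices to bound the ratio of the two sequences above and below by
  positive constants independent of n.  The moments of N ~ Binomial(M+1, p)
  are controlled by E[N f(N)] = (M+1) p E[f(N'+1)] with N' ~ Binomial(M, p):
  by induction E[(1+N)^m] <= K_m (1 + E N)^m, and the second moment is explicit.
  Non-integer powers are compared pointwise with polynomials.  If A < B, then
  2k - k^2 <= k^s <= k^m for naturals k and an integer m >= s.  If A > B, then
  x := N / E N satisfies c (3x - x^2 - 1/2) <= x^s <= 1 + x^m, where the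
  left-hand side has positive mean because E x = 1 and E x^2 <= 2.
*)

(** * Reduction to a bounded ratio *)

(** The logarithm of the ratio stays in the fixed interval from [ln c] to [ln C], so the factor 1/n
    sends it to 0. *)
Lemma exp_equiv_bounded_ratio (R : realType) (a b : nat -> R) (c C : R) :
  0 < c -> (forall n, (0 < n)%N -> 0 < b n) ->
  (forall n, (0 < n)%N -> c * b n <= a n <= C * b n) -> exp_equiv a b.
Proof.
move=> c0 b0 ab.
have a0 n : (0 < n)%N -> 0 < a n.
  move=> n0; have /andP[+ _] := ab _ n0; apply: lt_le_trans.
  by rewrite mulr_gt0// b0.
split=> //.
have bnd n : (0 < n)%N -> ln c <= ln (a n / b n) <= ln C.
  move=> n0; have /andP[ca aC] := ab _ n0.
  have bn := b0 _ n0; have an := a0 _ n0.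
  have abn : 0 < a n / b n by rewrite divr_gt0.
  have ac : c <= a n / b n by rewrite ler_pdivlMr.
  have aC' : a n / b n <= C by rewrite ler_pdivrMr.
  rewrite !ler_ln ?posrE ?ac ?aC'//.
  exact: lt_le_trans aC'.
have inv0 (l : R) : n%:R^-1 * l @[n --> \oo] --> (0 : R).
  rewrite -(mul0r l); apply: cvgMl.
  apply/gtr0_cvgV0; last exact: cvgr_idn.
  by near=> n; rewrite ltr0n; near: n; exact: nbhs_infty_gt.
apply: (@squeeze_cvgr _ _ _ _ (fun n => n%:R^-1 * ln c)
                              (fun n => n%:R^-1 * ln C)) => //.
near=> n; have n0 : (0 < n)%N by near: n; exact: nbhs_infty_gt.
by have /andP[h1 h2] := bnd _ n0; rewrite !ler_wpM2l ?invr_ge0 ?ler0n.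
Unshelve. all: by end_near.
Qed.

(** * Binomial expectations as finite sums *)

Definition bin_expect (R : realType) (M : nat) (p : R) (f : nat -> R) : R :=
  \sum_(k < M.+1) binomial_pmf M p k * f k.

(** Change of variables to the law of [N], whose integral is a finite sum of real numbers; hence
    [fine] loses nothing. *)
Lemma expectation_binomial (R : realType) (M : nat) (p : R)
    (d : measure_display) (T : measurableType d) (P : probability T R)
    (N : {RV P >-> nat}) (f : nat -> R) :
  0 <= p <= 1 -> (forall k, 0 <= f k) ->
  distribution P N =1 binomial_prob M p ->
  fine 'E_P[fun w => f (N w)] = bin_expect M p f.
Proof.
move=> /andP[p0 p1] f0 NE; rewrite unlock.
rewrite -(@ge0_integral_distribution _ _ _ _ _ P N (EFin \o f))//.
rewrite (eq_measure_integral (binomial_prob M p)); last first.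
  by move=> U mU sU; exact: NE.
rewrite (@integral_binomial _ M p p0 p1 (EFin \o f))//=.
by under eq_bigr do rewrite -EFinM; rewrite sumEFin.
Qed.

Section bin_expect.
Context (R : realType).
Implicit Types (M : nat) (p : R) (f g : nat -> R).

Lemma bin_expectD M p f g :
  bin_expect M p (fun k => f k + g k) = bin_expect M p f + bin_expect M p g.
Proof. by rewrite -big_split; apply: eq_bigr => k _; rewrite mulrDr. Qed.

Lemma bin_expectZ M p a f :
  bin_expect M p (fun k => a * f k) = a * bin_expect M p f.
Proof. by rewrite mulr_sumr; apply: eq_bigr => k _; rewrite mulrCA. Qed.

Lemma le_bin_expect M p f g : 0 <= p <= 1 -> (forall k, f k <= g k) ->
  bin_expect M p f <= bin_expect M p g.
Proof.
by move=> p01 fg; apply: ler_sum => k _; rewrite ler_wpM2l// binomial_pmf_ge0.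
Qed.

Lemma bin_expect_cst M p a : bin_expect M p (fun=> a) = a.
Proof.
rewrite /bin_expect -mulr_suml /binomial_pmf.
under eq_bigr do rewrite mulrC.
by rewrite -exprDn subrK expr1n mul1r.
Qed.

(** Size biasing: the term k = 0 vanishes, and (k+1) C(M+1, k+1) = (M+1) C(M, k) absorbs the factor
    k in the others. *)
Lemma bin_expect_mulk M p f :
  bin_expect M.+1 p (fun k => k%:R * f k) =
  M.+1%:R * p * bin_expect M p (fun k => f k.+1).
Proof.
rewrite /bin_expect big_ord_recl/= mul0r mulr0 add0r mulr_sumr.
apply: eq_bigr => k _; rewrite /binomial_pmf /bump/= add1n subSS !mulrA.
congr (_ * _).
rewrite -(mulr_natr _ 'C(_, _)) -(mulr_natr _ 'C(M, k)) exprS.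
have E : M.+1%:R * 'C(M, k)%:R = k.+1%:R * 'C(M.+1, k.+1)%:R :> R.
  by rewrite -!natrM mul_bin_diag.
transitivity (p * p ^+ k * unstable.onem p ^+ (M - k) *
  (k.+1%:R * 'C(M.+1, k.+1)%:R)); first by ring.
by rewrite -E; ring.
Qed.

Lemma bin_expect_id M p : bin_expect M p (fun k => k%:R) = M%:R * p.
Proof.
case: M => [|M]; first by rewrite /bin_expect big_ord1 mulr0 mul0r.
transitivity (bin_expect M.+1 p (fun k => k%:R * 1)).
  by apply: eq_bigr => k _; rewrite mulr1.
by rewrite bin_expect_mulk bin_expect_cst mulr1.
Qed.

Lemma bin_expect_sqr M p :
  bin_expect M.+1 p (fun k => k%:R ^+ 2) = M.+1%:R * p * (1 + M%:R * p).
Proof.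
rewrite (bin_expect_mulk _ _ (fun k => k%:R)); congr (_ * _).
transitivity (bin_expect M p (fun k => 1 + k%:R)).
  by apply: eq_bigr => k _; rewrite nat1r.
by rewrite (bin_expectD _ _ (fun=> 1)) bin_expect_cst bin_expect_id.
Qed.

(** * Integer moments *)

(** Induction on m through (k+1)^(m+1) = (k+1)^m + k (k+1)^m. Size biasing turns the last term into
    a moment of k+2, and k+2 <= 2(k+1) returns to the induction hypothesis at the cost of 2^m. *)
Lemma bin_expect_exprS_le (m : nat) : exists2 K : R, 0 < K &
  forall M p, 0 <= p <= 1 ->
    bin_expect M p (fun k => k.+1%:R ^+ m) <= K * (1 + M%:R * p) ^+ m.
Proof.
elim: m => [|m [K K0 IH]].
  by exists 1 => // M p _; rewrite bin_expect_cst expr0 mulr1.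
exists (K * 2 ^+ m) => [|M p p01]; first by rewrite mulr_gt0 ?exprn_gt0.
have p0 : 0 <= p by case/andP: p01.
have E : bin_expect M p (fun k => k.+1%:R ^+ m.+1) =
    bin_expect M p (fun k => k.+1%:R ^+ m) +
    bin_expect M p (fun k => k%:R * k.+1%:R ^+ m).
  rewrite -bin_expectD; apply: eq_bigr => k _; congr (_ * _).
  by rewrite exprS -nat1r mulrDl mul1r.
have m2 : 1 <= 2 ^+ m :> R by rewrite exprn_ege1// ler1n.
have Mp0 : 0 <= M%:R * p by rewrite mulr_ge0.
have X0 : 0 <= K * (1 + M%:R * p) ^+ m.
  by rewrite mulr_ge0 ?exprn_ge0 ?addr_ge0// ltW.
suff H : bin_expect M p (fun k => k%:R * k.+1%:R ^+ m) <=
    M%:R * p * (2 ^+ m * (K * (1 + M%:R * p) ^+ m)).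
  rewrite E (le_trans (lerD (IH M p p01) H))// exprS.
  rewrite [leRHS](_ : _ = 2 ^+ m * (K * (1 + M%:R * p) ^+ m) +
    M%:R * p * (2 ^+ m * (K * (1 + M%:R * p) ^+ m))); last by ring.
  by rewrite lerD2r ler_peMl.
(* Size biasing needs at least one trial; with none, both sides are 0. *)
case: M {E} Mp0 X0 => [|M] Mp0 X0.
  by rewrite /bin_expect big_ord1 !mul0r mulr0.
rewrite bin_expect_mulk; apply: ler_wpM2l => //.
have le2 : bin_expect M p (fun k => k.+2%:R ^+ m) <=
    2 ^+ m * bin_expect M p (fun k => k.+1%:R ^+ m).
  rewrite -bin_expectZ; apply: le_bin_expect => // k.
  rewrite -exprMn lerXn2r ?nnegrE ?ler0n// -natrM ler_nat mul2n -addnn.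
  by rewrite addSn addnS !ltnS leq_addl.
apply: (le_trans le2); rewrite ler_wpM2l ?exprn_ge0//.
apply: (le_trans (IH M p p01)); rewrite ler_wpM2l ?(ltW K0)//.
by rewrite lerXn2r ?nnegrE ?addr_ge0 ?mulr_ge0// lerD2l ler_wpM2r// ler_nat.
Qed.

(** Size biasing one factor k keeps the mean as a factor of the bound, which makes the bound sharp
    enough when the mean tends to 0. *)
Lemma bin_expect_exprn_le (m : nat) : exists2 K : R, 0 < K &
  forall M p, 0 <= p <= 1 -> bin_expect M.+1 p (fun k => k%:R ^+ m.+1) <=
    K * (M.+1%:R * p) * (1 + M.+1%:R * p) ^+ m.
Proof.
have [K K0 KP] := bin_expect_exprS_le m; exists K => // M p p01.
have p0 : 0 <= p by case/andP: p01.
rewrite [leLHS](_ : _ = bin_expect M.+1 p (fun k => k%:R * k%:R ^+ m)).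
  2: by apply: eq_bigr => k _; rewrite exprS.
rewrite (bin_expect_mulk _ _ (fun k => k%:R ^+ m)) (mulrC K) -[leRHS]mulrA.
rewrite ler_wpM2l ?mulr_ge0//.
apply: (le_trans (KP M p p01)); rewrite ler_wpM2l ?(ltW K0)//.
by rewrite lerXn2r ?nnegrE ?addr_ge0 ?mulr_ge0// lerD2l ler_wpM2r// ler_nat.
Qed.

(** * Pointwise comparison of real powers with polynomials *)

Lemma powR_le_exprn (s x : R) (m : nat) : s <= m%:R -> 1 <= x ->
  x `^ s <= x ^+ m.
Proof.
move=> sm x1; rewrite -powR_mulrn ?(le_trans ler01)//; exact: ler_powR.
Qed.

(** The quadratic agrees with k^s at 0 and 1 and is nonpositive from 2 on. Both bounds vanish at 0:
    an additive constant would swamp a mean that tends to 0. *)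
Lemma natr_powR_bounds (s : R) (m k : nat) : 0 < s -> s <= m.+1%:R ->
  2 * k%:R - k%:R ^+ 2 <= k%:R `^ s <= k%:R ^+ m.+1.
Proof.
move=> s0 sm; case: k => [|k].
  (* Here s > 0 matters, since 0 to the power 0 is 1. *)
  by rewrite powR0 ?gt_eqF// !expr0n/= mulr0 subr0 !lexx.
rewrite powR_le_exprn ?ler1n// andbT.
case: k => [|k]; first by rewrite powR1 expr1n; lra.
apply: le_trans (powR_ge0 _ _).
by rewrite expr2 -mulrBl mulr_le0_ge0// subr_le0 ler_nat.
Qed.

Lemma powR_le_1Dexprn (s x : R) (m : nat) : 0 < s -> s <= m%:R -> 0 <= x ->
  x `^ s <= 1 + x ^+ m.
Proof.
move=> s0 sm x0; have [x1|/ltW x1] := leP x 1.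
  apply: (@le_trans _ _ 1); last by rewrite lerDl exprn_ge0.
  have := @ge0_ler_powR _ s (ltW s0) x 1; rewrite powR1; apply=> //.
  by rewrite nnegrE.
by apply: (le_trans (powR_le_exprn sm x1)); rewrite lerDr.
Qed.

(** For x <= 1/6 the quadratic is nonpositive. Beyond 1/6 it is at most its maximum 7/4, hence below
    3, while x^s is at least (1/6)^s. *)
Lemma powR_ge_quadratic (s x : R) : 0 < s -> 0 <= x ->
  6^-1 `^ s / 3 * (3 * x - x ^+ 2 - 2^-1) <= x `^ s.
Proof.
move=> s0 x0; have c0 : 0 < 6^-1 `^ s :> R by rewrite powR_gt0// invr_gt0.
have [x6|x6] := leP x 6^-1.
  apply: le_trans (powR_ge0 _ _); rewrite mulr_ge0_le0 ?divr_ge0 ?powR_ge0//.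
  have := sqr_ge0 x; lra.
apply: (@le_trans _ _ (6^-1 `^ s)).
  rewrite -mulrA ler_piMr ?(ltW c0)//.
  have := sqr_ge0 (x - 3 / 2); rewrite sqrrB; lra.
by apply: ge0_ler_powR; rewrite ?nnegrE ?invr_ge0 ?(ltW s0) ?(ltW x6).
Qed.

(* Here [t] plays the role of e^(n(A-B)), which the ceiling in the number of
   trials separates from the mean [M.+1%:R * p]. *)
Lemma sparse_moment (s : R) : 0 < s -> exists2 K : R, 0 < K &
  forall M p t, 0 <= p <= t -> t <= 1 -> M%:R * p <= t <= M.+1%:R * p ->
    t * (1 - t) <= bin_expect M.+1 p (fun k => k%:R `^ s) <= K * t.
Proof.
move=> s0.
have [m sm] : exists m : nat, s <= m.+1%:R.
  exists (Num.truncn s); exact/ltW/truncnS_gt.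
have [K K0 KP] := bin_expect_exprn_le m.
(* The mean is Mp + p <= 2t, and 1 plus the mean is at most 3 because t <= 1. *)
exists (K * 2 * 3 ^+ m) => [|M p t /andP[p0 pt] t1 /andP[Mt tM]].
  by rewrite !mulr_gt0 ?exprn_gt0.
have p01 : 0 <= p <= 1 by rewrite p0 (le_trans pt).
have M2t : M.+1%:R * p <= 2 * t by rewrite -nat1r mulrDl mul1r mulrDl mul1r lerD.
apply/andP; split.
  apply: (@le_trans _ _ (bin_expect M.+1 p (fun k => 2 * k%:R - k%:R ^+ 2))).
    rewrite [leRHS](_ : _ = bin_expect M.+1 p
      (fun k => 2 * k%:R + -1 * k%:R ^+ 2)); last first.
      by apply: eq_bigr => k _; rewrite mulN1r.
    rewrite bin_expectD !bin_expectZ bin_expect_sqr bin_expect_id.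
    (* The two factors are bounded below separately: (M+1)p >= t and 1 - Mp >= 1 - t. *)
    rewrite [leRHS](_ : _ = M.+1%:R * p * (1 - M%:R * p)); last by ring.
    by apply: ler_pM; rewrite ?subr_ge0 ?(le_trans p0)// lerD2l lerN2.
  by apply: le_bin_expect => // k; have /andP[] := natr_powR_bounds k s0 sm.
apply: (@le_trans _ _ (bin_expect M.+1 p (fun k => k%:R ^+ m.+1))).
  by apply: le_bin_expect => // k; have /andP[] := natr_powR_bounds k s0 sm.
apply: (le_trans (KP M p p01)).
have Mp0 : 0 <= M.+1%:R * p by rewrite mulr_ge0.
rewrite [leRHS](_ : _ = K * (2 * t) * 3 ^+ m); last by ring.
apply: ler_pM; rewrite ?exprn_ge0 ?mulr_ge0 ?addr_ge0 ?(ltW K0)//.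
  by rewrite ler_wpM2l// ltW.
rewrite lerXn2r ?nnegrE ?addr_ge0//; lra.
Qed.

Lemma dense_moment (s : R) : 0 < s -> exists2 c : R, 0 < c & exists C : R,
  forall M p t, 0 <= p <= 1 -> 1 <= t -> M%:R * p <= t <= M.+1%:R * p ->
    c * t `^ s <= bin_expect M.+1 p (fun k => k%:R `^ s) <= C * t `^ s.
Proof.
move=> s0.
have [m sm] : exists m : nat, s <= m.+1%:R.
  exists (Num.truncn s); exact/ltW/truncnS_gt.
have [K K0 KP] := bin_expect_exprn_le m.
(* The last factor 1/2 bounds the mean of 3x - x^2 - 1/2 from below, as 3 - 2 - 1/2. *)
exists (6^-1 `^ s / 3 * 2^-1).
  by rewrite !mulr_gt0 ?powR_gt0 ?invr_gt0.
(* Here 2^s pays for replacing [mu] by t, as [mu] <= 2t, and 2^m comes from 1 + [mu] <= 2 [mu]. *)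
exists (2 `^ s * (1 + K * 2 ^+ m)) => M p t p01 t1 /andP[Mt tM].
have [p0 p1] := andP p01.
set mu := M.+1%:R * p.
have mu1 : 1 <= mu by exact: le_trans tM.
have mu0 : 0 < mu by exact: lt_le_trans mu1.
have mu2t : mu <= 2 * t by rewrite /mu -nat1r; lra.
have t0 : 0 < t by exact: lt_le_trans t1.
have ->: bin_expect M.+1 p (fun k => k%:R `^ s) =
    mu `^ s * bin_expect M.+1 p (fun k => (k%:R / mu) `^ s).
  rewrite -bin_expectZ; apply: eq_bigr => k _; congr (_ * _).
  by rewrite -powRM ?divr_ge0 ?(ltW mu0)// mulrC divfK ?gt_eqF.
apply/andP; split.
  rewrite mulrC ler_pM ?powR_ge0//.
    by apply: ge0_ler_powR; rewrite ?nnegrE ?(ltW s0) ?(ltW t0) ?(ltW mu0).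
  set c := _ / 3.
  have c0 : 0 < c by rewrite divr_gt0 ?powR_gt0 ?invr_gt0.
  apply: (@le_trans _ _ (bin_expect M.+1 p
      (fun k => c * (3 * (k%:R / mu) - (k%:R / mu) ^+ 2 - 2^-1)))); last first.
    by apply: le_bin_expect => // k; apply: powR_ge_quadratic;
      rewrite // divr_ge0 ?(ltW mu0).
  rewrite bin_expectZ ler_wpM2l ?(ltW c0)//.
  rewrite [leRHS](_ : _ = bin_expect M.+1 p (fun k => 3 / mu * k%:R +
      ((- mu^-1 ^+ 2) * k%:R ^+ 2 + - 2^-1))); last first.
    by apply: eq_bigr => k _; congr (_ * _); rewrite exprMn; ring.
  rewrite !bin_expectD !bin_expectZ bin_expect_cst bin_expect_sqr bin_expect_id.
  rewrite -/mu mulfVK ?gt_eqF//.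
  rewrite [X in _ <= _ + (X + _)](_ : _ = - ((1 + M%:R * p) / mu)); last first.
    by field; rewrite gt_eqF.
  (* This quotient is the second moment of k/[mu]; both 1 and Mp are at most [mu]. *)
  have : (1 + M%:R * p) / mu <= 2.
    rewrite ler_pdivrMr//; have : M%:R * p <= mu := le_trans Mt tM; lra.
  lra.
rewrite mulrAC -powRM ?(ltW t0)// ler_pM ?powR_ge0//.
- by apply: sumr_ge0 => k _; rewrite mulr_ge0 ?binomial_pmf_ge0 ?powR_ge0.
- by apply: ge0_ler_powR;
    rewrite ?nnegrE ?mulr_ge0 ?(ltW s0) ?(ltW t0) ?(ltW mu0).
apply: (@le_trans _ _
    (bin_expect M.+1 p (fun k => 1 + mu ^- m.+1 * k%:R ^+ m.+1))).
  apply: le_bin_expect => // k; rewrite [X in 1 + X]mulrC -exprVn -exprMn.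
  by apply: powR_le_1Dexprn; rewrite // divr_ge0 ?(ltW mu0).
rewrite bin_expectD bin_expectZ bin_expect_cst lerD2l.
rewrite mulrC ler_pdivrMr ?exprn_gt0//.
apply: (le_trans (KP M p p01)); rewrite -/mu.
rewrite [leRHS](_ : _ = K * mu * (2 * mu) ^+ m); last first.
  by rewrite (exprMn _ 2) (exprS mu); ring.
have Kmu : 0 <= K * mu by rewrite mulr_ge0 ?ltW.
rewrite ler_wpM2l// lerXn2r ?nnegrE ?addr_ge0 ?mulr_ge0 ?(ltW mu0)//; lra.
Qed.

End bin_expect.

(** * Rounding and conclusion *)

(** The successor form lets size biasing apply to the number of trials. *)
Lemma absz_ceil_succ (R : archiRealDomainType) (x : R) : 0 < x ->
  exists2 M : nat, `|Num.ceil x|%N = M.+1 & M%:R <= x <= M.+1%:R.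
Proof.
rewrite -ceil_gt0; have := ceil_itv x.
case: (Num.ceil _) => [[|M]|]// /andP[h1 h2] _.
exists M => //; rewrite h2 andbT ltW//.
by move: h1; rewrite -addn1 PoszD addrK.
Qed.

Theorem theorem2 (R : realType) (A B s : R)
    (d : nat -> measure_display) (T : forall n : nat, measurableType (d n))
    (P : forall n : nat, probability (T n) R)
    (N : forall n : nat, {RV (P n) >-> nat})
    (hA : 0 < A) (hB : 0 < B) (hs : 0 < s)
    (hN : forall n : nat, (0 < n)%N ->
       distribution (P n) (N n) =1
         binomial_prob `|Num.ceil (expR (n%:R * A))|%N (expR (- (n%:R * B)))) :
  (B < A ->
     exp_equiv (fun n => fine 'E_(P n)[fun w => (N n w)%:R `^ s])
               (fun n => expR (n%:R * (A - B) * s)))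
  /\
  (A < B ->
     exp_equiv (fun n => fine 'E_(P n)[fun w => (N n w)%:R `^ s])
               (fun n => expR (- (n%:R * (B - A))))).
Proof.
have p01 n : 0 <= expR (- (n%:R * B)) <= 1.
  by rewrite expR_ge0 -expR0 ler_expR oppr_le0 mulr_ge0// ltW.
(* Multiplying M <= e^(nA) <= M+1 by p = e^(-nB) places t = e^(n(A-B)) between Mp and (M+1)p. *)
have key n : (0 < n)%N -> exists2 M : nat,
    M%:R * expR (- (n%:R * B)) <= expR (n%:R * (A - B)) <=
      M.+1%:R * expR (- (n%:R * B)) &
    fine 'E_(P n)[fun w => (N n w)%:R `^ s] =
      bin_expect M.+1 (expR (- (n%:R * B))) (fun k => k%:R `^ s).
  move=> n0; have [M ME /andP[M1 M2]] := absz_ceil_succ (expR_gt0 (n%:R * A)).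
  exists M.
    by rewrite mulrBr expRD !ler_wpM2r ?expR_ge0.
  apply: (expectation_binomial (f := fun k => k%:R `^ s)).
  - exact: p01.
  - by move=> k; exact: powR_ge0.
  - by rewrite -ME; exact: hN.
split=> [BA|AB].
  have [c c0 [C cC]] := dense_moment hs.
  apply: (exp_equiv_bounded_ratio c0) => [n _|n n0]; first exact: expR_gt0.
  have [M Mt ->] := key n n0; rewrite expRM; apply: cC => //.
  by rewrite -expR0 ler_expR mulr_ge0// subr_ge0 ltW.
have [K K0 KP] := sparse_moment hs.
(* For n >= 1, t <= e^(A-B) < 1, so the factor 1 - t of the lower bound is at least this
   constant. *)
have c0 : 0 < 1 - expR (A - B) by rewrite subr_gt0 -expR0 ltr_expR subr_lt0.
apply: (@exp_equiv_bounded_ratio _ _ _ _ K c0) => [n _|n n0].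
  exact: expR_gt0.
have [M Mt ->] := key n n0; rewrite -mulrN opprB.
have n1 : 1 <= n%:R :> R by rewrite ler1n.
have te : expR (n%:R * (A - B)) <= expR (A - B).
  by rewrite ler_expR ger_nMl// subr_lt0.
have /andP[lo ->] : expR (n%:R * (A - B)) * (1 - expR (n%:R * (A - B))) <=
    bin_expect M.+1 (expR (- (n%:R * B))) (fun k => k%:R `^ s) <=
    K * expR (n%:R * (A - B)).
  apply: KP => //.
    rewrite expR_ge0 ler_expR mulrBr lerDr mulr_ge0// ltW//.
  apply: (le_trans te); lra.
rewrite andbT (le_trans _ lo)// mulrC ler_wpM2l ?expR_ge0//; lra.
Qed.
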